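(* Let $(\mathfrak{U},\mathcal{U})$ be a measurable space, let $U$ be a random variable with values in $\mathfrak{U}$ and non-atomic law, let $f:\mathfrak{U}\to\mathbb{R}$ be measurable with $\mathbb{E}|f(U)|<\infty$, let $n\ge 1$ be an integer, and let $\varepsilon$ be a real random variable with mean $0$ and finite variance. Let $\mathcal{B}$ and $\mathcal{C}$ be admissible partitions of $\mathfrak{U}$ (all with respect to the same $n$). If $\mathcal{C}\le_{\mathrm{ref.}}\mathcal{B}$ (that is, $\mathcal{B}$ is a refinement of $\mathcal{C}$), then $$\operatorname{Var}[W_{\mathrm{IE}}^{\mathcal{B}}]\le\operatorname{Var}[W_{\mathrm{IE}}^{\mathcal{C}}],$$ where variances take values in $[0,\infty]$.
   Context: Fix $n$ and let $N=\{1,\dots,n\}$. An admissible partition of $\mathfrak{U}$ is a finite sequence $\mathcal{B}=(B_1,\dots,B_b)$ of pairwise disjoint measurable sets with union $\mathfrak{U}$ such that $\mathbb{P}(U\in B_i)=k_i/n$ with $k_i\in\{1,\dots,n\}$ and $\sum_i k_i=n$. A partition $\mathcal{B}^*=(B_1^*,\dots,B_b^* )$ of $N$ is associated to $\mathcal{B}$ if $|B_i^*|=k_i$ for all $i$; each admissible $\mathcal{B}$ is taken together with an associated $\mathcal{B}^*$, and for $B=B_i\in\mathcal{B}$ one writes $B^*=B_i^*$, so that $\mathbb{P}(U\in B)=|B^*|/n$. (The laws of the estimators below do not depend on which associated partition is chosen.) $\mathcal{C}\le_{\mathrm{ref.}}\mathcal{B}$ means that every set in $\mathcal{C}$ is a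 union of sets in $\mathcal{B}$. For $B\in\mathcal{B}$, $P_{U|B}$ denotes the conditional law of $U$ given $U\in B$. Let $\{V_j^B: j\in B^*, B\in\mathcal{B}\}$ be independent random variables with $V_j^B$ having law $P_{U|B}$, and let $\varepsilon_1,\dots,\varepsilon_n$ be independent copies of $\varepsilon$, independent of the variables $V_j^B$. Define $$W_{\mathrm{IE}}^{\mathcal{B}}=\frac1n\sum_{B\in\mathcal{B}}\sum_{j\in B^*}\bigl(f(V_j^B)+\varepsilon_j\bigr),$$ and define $W_{\mathrm{IE}}^{\mathcal{C}}$ in the same way from $\mathcal{C}$. *)

(* Defs.v *)
From HB Require Import structures.
From mathcomp Require Import all_boot all_order all_algebra.
From mathcomp Require Import all_classical all_reals all_analysis.

Set Implicit Arguments.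
Unset Strict Implicit.
Unset Printing Implicit Defensive.

Import Order.TTheory GRing.Theory Num.Theory.
Import numFieldNormedType.Exports.

Local Open Scope classical_set_scope.
Local Open Scope ring_scope.

Definition non_atomic d (T : measurableType d) (R : realType)
    (mu : set T -> \bar R) : Prop :=
  forall A, measurable A -> (0 < mu A)%E ->
    exists A', [/\ measurable A', A' `<=` A, (0 < mu A')%E & (mu A' < mu A)%E].

Definition same_law d (T : measurableType d) (R : realType)
    (mu nu : set T -> \bar R) : Prop :=
  forall A, measurable A -> mu A = nu A.

Definition cond_law dO d (Omega : measurableType dO) (T : measurableType d)
    (R : realType) (P : probability Omega R) (U : {RV P >-> T}) (B : set T)
    : set T -> \bar R :=
  fun A => (P (U @^-1` A `&` U @^-1` B) / P (U @^-1` B))%E.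

Section independence.
Context dO (Omega : measurableType dO) (R : realType) (P : probability Omega R).

Definition mutually_independent d (T : measurableType d) (I : finType)
    (D : {set I}) (X : I -> Omega -> T) : Prop :=
  forall (J : {set I}) (E : I -> set T),
    J \subset D -> (forall i, i \in J -> measurable (E i)) ->
    P (\bigcap_(i in [set` J]) X i @^-1` E i) =
    (\prod_(i in J) P (X i @^-1` E i))%E.

Definition generated_sigma d (T : measurableType d) (I : finType)
    (D : {set I}) (X : I -> Omega -> T) : set (set Omega) :=
  <<s \bigcup_(i in [set` D]) preimage_set_system setT (X i) measurable >>.

Definition independent_families d d' (T : measurableType d)
    (T' : measurableType d') (I J : finType)
    (D : {set I}) (X : I -> Omega -> T)
    (D' : {set J}) (Y : J -> Omega -> T') : Prop :=
  forall E F, generated_sigma D X E -> generated_sigma D' Y F ->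
    P (E `&` F) = (P E * P F)%E.

End independence.

Section partitions.
Context dO d (Omega : measurableType dO) (T : measurableType d) (R : realType)
  (P : probability Omega R) (U : {RV P >-> T}) (n : nat).

Record admissible (b : nat) (B : 'I_b -> set T) (k : 'I_b -> nat) : Prop := {
  adm_measurable : forall i, measurable (B i);
  adm_disjoint : trivIset [set: 'I_b] B;
  adm_cover : \bigcup_i B i = [set: T];
  adm_range : forall i, (1 <= k i <= n)%N;
  adm_prob : forall i, P (U @^-1` B i) = ((k i)%:R / n%:R)%:E;
  adm_sum : (\sum_(i < b) k i)%N = n
}.

(* The set N = {1, ..., n} is represented by 'I_n. *)
Record associated (b : nat) (k : 'I_b -> nat) (Bs : 'I_b -> {set 'I_n})
    : Prop := {
  assoc_disjoint : forall i i' j, j \in Bs i -> j \in Bs i' -> i = i';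
  assoc_cover : forall j : 'I_n, exists i, j \in Bs i;
  assoc_card : forall i, #|Bs i| = k i
}.

Definition refines (b c : nat) (B : 'I_b -> set T) (C : 'I_c -> set T) : Prop :=
  forall l, exists J : {set 'I_b}, C l = \bigcup_(i in [set` J]) B i.

Definition IE_pairs (b : nat) (Bs : 'I_b -> {set 'I_n}) : {set 'I_b * 'I_n} :=
  finset (fun p : 'I_b * 'I_n => p.2 \in Bs p.1).

(* V i j stands for V_j^(B_i); it is used, and constrained, only when j
   belongs to Bs i. The sample space Omega' of the estimator need not be the
   one carrying U or eps. *)
Record IE_sample (eps : {RV P >-> R})
    (b : nat) (B : 'I_b -> set T) (Bs : 'I_b -> {set 'I_n})
    d' (Omega' : measurableType d') (P' : probability Omega' R)
    (V : 'I_b -> 'I_n -> {RV P' >-> T}) (e : 'I_n -> {RV P' >-> R})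
    : Prop := {
  IE_law_V : forall i j, j \in Bs i ->
    same_law (distribution P' (V i j)) (cond_law U (B i));
  IE_law_eps : forall j,
    same_law (distribution P' (e j)) (distribution P eps);
  IE_indep_V :
    mutually_independent P' (IE_pairs Bs) (fun p => V p.1 p.2 : Omega' -> T);
  IE_indep_eps :
    mutually_independent P' [set: 'I_n]%SET (fun j => e j : Omega' -> R);
  IE_indep_V_eps :
    independent_families P' (IE_pairs Bs) (fun p => V p.1 p.2 : Omega' -> T)
      [set: 'I_n]%SET (fun j => e j : Omega' -> R)
}.

End partitions.

Definition W_IE d (T : measurableType d) (R : realType) (n : nat)
    (f : T -> R) (b : nat) (Bs : 'I_b -> {set 'I_n})
    d' (Omega' : measurableType d') (P' : probability Omega' R)
    (V : 'I_b -> 'I_n -> {RV P' >-> T}) (e : 'I_n -> {RV P' >-> R})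
    : Omega' -> R :=
  fun w => n%:R^-1 * \sum_(i < b) \sum_(j in Bs i) (f (V i j w) + e j w).

(* Main.v *)
Require Import Defs.
From HB Require Import structures.
From mathcomp Require Import all_boot all_order all_algebra.
From mathcomp Require Import all_classical all_reals all_analysis.
From mathcomp Require Import measurable_realfun ring.
Import Order.TTheory GRing.Theory Num.Theory.
Import numFieldNormedType.Exports.
Local Open Scope classical_set_scope.
Local Open Scope ring_scope.
Local Open Scope ereal_scope.

(** The variance of an integrable random variable is the least value over real
    [m] of the mean square deviation from [m]. For a measure [mu] on the space
    of [U] and a set [A], let [spread mu g A] be the infimum over [m] of the
    integral over [A] of [(g - m) ^ 2]. Take for [mu] the law of [U]. If [V]
    has the law of [U] conditioned on the block [B i], of probability [k i / n],
    then the variance of [g V] is [n / k i] times [spread mu g (B i)], so the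
    [k i] draws from that block together contribute [n * spread mu g (B i)].

    The summands of the estimator are pairwise independent, hence its variance
    is the sum of their variances; with [g = f / n] this gives
    [n * \sum_i spread mu g (B i)] plus a noise term which is the same for all
    partitions ([variance_W_IE]). Refining a partition can only decrease the sum
    of spreads, because one constant per small block does at least as well as
    one constant for the whole block ([sum_spread_le]).

    Nothing forces [f U] to be square integrable, so all of this has to hold in
    [0, +oo]. The delicate point is additivity of variances when one of them is
    infinite: some summand [Y k] having infinite variance must make the sum have
    infinite variance. This is obtained from pairwise independence alone, by
    truncating [Y k] ([truncated_sqr_le]). *)

(** * Independence and expectations of products *)

Definition independent_pair {d d1 d2} {Omega : measurableType d}
    {T1 : measurableType d1} {T2 : measurableType d2} {R : realType}
    (P : probability Omega R) (X : Omega -> T1) (Y : Omega -> T2) : Prop :=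
  forall E F, measurable E -> measurable F ->
    P (X @^-1` E `&` Y @^-1` F) = P (X @^-1` E) * P (Y @^-1` F).

Lemma independent_pair_comp {d d1 d2 e1 e2} {Omega : measurableType d}
    {T1 : measurableType d1} {T2 : measurableType d2}
    {S1 : measurableType e1} {S2 : measurableType e2} {R : realType}
    {P : probability Omega R} {X : Omega -> T1} {Y : Omega -> T2}
    {g : T1 -> S1} {h : T2 -> S2} :
  measurable_fun [set: T1] g -> measurable_fun [set: T2] h ->
  independent_pair P X Y -> independent_pair P (g \o X) (h \o Y).
Proof.
move=> mg mh XY E F mE mF; apply: (XY (g @^-1` E) (h @^-1` F)).
- by rewrite -[X in measurable X]setTI; exact: mg.
- by rewrite -[X in measurable X]setTI; exact: mh.
Qed.

Section product_expectation.
Context {d} {Omega : measurableType d} {R : realType} {P : probability Omega R}.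
Context {X Y : Omega -> R}.
Hypothesis iX : P.-integrable [set: Omega] (EFin \o X).
Hypothesis iY : P.-integrable [set: Omega] (EFin \o Y).
Hypothesis XY : independent_pair P X Y.

Let mX : measurable_fun [set: Omega] X.
Proof. exact/measurable_EFinP/(measurable_int _ iX). Qed.
Let mY : measurable_fun [set: Omega] Y.
Proof. exact/measurable_EFinP/(measurable_int _ iY). Qed.
#[local] HB.instance Definition _ := isMeasurableFun.Build _ _ _ _ X mX.
#[local] HB.instance Definition _ := isMeasurableFun.Build _ _ _ _ Y mY.

Let joint := fun w => (X w, Y w).
Let measurable_joint : measurable_fun [set: Omega] joint.
Proof. exact: measurable_fun_pair. Qed.
#[local] HB.instance Definition _ :=
  isMeasurableFun.Build _ _ _ _ joint measurable_joint.

Let muX := distribution P X.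
Let muY := distribution P Y.
Let mul (z : R * R) := (z.1 * z.2)%:E.

(* A measure on the product is determined by its values on rectangles. *)
Let joint_law A : measurable A ->
  distribution P joint A = (muX \x muY) A.
Proof.
by move=> mA; apply/esym; apply: product_measure_unique.
Qed.

Let mmul : measurable_fun [set: R * R] mul.
Proof. by apply/measurable_EFinP; exact: measurable_funM. Qed.

Let integrable_id {Z : Omega -> R} (mZ : measurable_fun setT Z) :
  P.-integrable [set: Omega] (EFin \o Z) ->
  (pushforward P Z).-integrable [set: R] (fun x => x%:E).
Proof.
by move=> iZ; apply: integrable_pushforward => //; exact/measurable_EFinP.
Qed.

Let imul : (muX \x muY).-integrable [set: R * R] mul.
Proof.
apply/integrable12ltyP => //.
rewrite (eq_integral
  (fun x : R => `|x%:E| * \int[muY]_(y in [set: R]) `|y%:E|)); last first.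
  move=> x _; rewrite -ge0_integralZl//.
  - by apply: eq_integral => y _; rewrite /mul/= normrM EFinM.
  - exact: measurableT_comp.
rewrite ge0_integralZr//; last 2 first.
- exact: measurableT_comp.
- exact: integral_ge0.
have /integrableP[_ hX] := integrable_id mX iX.
have /integrableP[_ hY] := integrable_id mY iY.
rewrite lte_mul_pinfty//; first exact: integral_ge0.
by rewrite ge0_fin_numE//; exact: integral_ge0.
Qed.

Let ijoint : (distribution P joint).-integrable [set: R * R] mul.
Proof.
apply/integrableP; split => //.
rewrite (eq_measure_integral (muX \x muY)); last by move=> *; exact: joint_law.
by have /integrableP[] := imul.
Qed.

(** The joint law is the product of the marginal laws, so by Tonelli's theorem
    the mean of [`|X * Y|] is the product of the means of [`|X|] and [`|Y|]. *)
Lemma integrable_mul_independent :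
  P.-integrable [set: Omega] (EFin \o (X \* Y)%R).
Proof.
apply/integrableP; split.
  by apply/measurable_EFinP; exact: measurable_funM.
have /integrableP[_] := ijoint.
by rewrite ge0_integral_distribution//; exact: measurableT_comp.
Qed.

Lemma integral_mul_independent :
  \int[P]_w (X w * Y w)%:E = \int[P]_w (X w)%:E * \int[P]_w (Y w)%:E.
Proof.
transitivity (\int[distribution P joint]_z mul z).
  by rewrite integral_distribution//; exact: integrable_mul_independent.
rewrite (eq_measure_integral (muX \x muY)); last by move=> *; exact: joint_law.
rewrite -integral12_prod_meas1//.
have EX : \int[P]_w (X w)%:E = \int[muX]_(x in [set: R]) x%:E.
  by rewrite integral_distribution.
have EY : \int[P]_w (Y w)%:E = \int[muY]_(x in [set: R]) x%:E.
  by rewrite integral_distribution.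
rewrite EX EY.
have fY : \int[muY]_(y in [set: R]) y%:E \is a fin_num.
  by rewrite -EY; exact: integrable_fin_num.
rewrite (eq_integral
  (fun x : R => x%:E * \int[muY]_(y in [set: R]) y%:E)); last first.
  move=> x _; rewrite -integralZl//.
  exact: (integrable_id mY iY).
rewrite -(fineK fY) integralZr//.
exact: (integrable_id mX iX).
Qed.

End product_expectation.

(** * Variance of a sum of pairwise independent variables *)

Section variance_sum.
Context {d} {Omega : measurableType d} {R : realType} {P : probability Omega R}.

Lemma varianceE_integral (X : Omega -> R) :
  'V_P[X] = \int[P]_w ((X w - fine 'E_P[X]) ^+ 2)%:E.
Proof.
have expectationE Z : 'E_P[Z] = \int[P]_w (Z w)%:E by rewrite unlock.
rewrite /variance covariance.unlock [LHS]expectationE.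
by apply: eq_integral => w _; rewrite expr2.
Qed.

Lemma integrable_centered (X : Omega -> R) (m : R) :
  P.-integrable [set: Omega] (EFin \o X) ->
  P.-integrable [set: Omega] (EFin \o (fun w => X w - m)%R).
Proof.
move=> iX; rewrite (_ : _ \o _ = (EFin \o X) \- (EFin \o cst m)); last first.
  by apply/funext => w /=; rewrite EFinB.
by apply: integrableB => //; exact: finite_measure_integrable_cst.
Qed.

Lemma integral_centered (X : Omega -> R) :
  P.-integrable [set: Omega] (EFin \o X) ->
  \int[P]_w (X w - fine 'E_P[X])%:E = 0.
Proof.
move=> iX; set m := fine _.
have -> : \int[P]_w (X w - m)%:E =
    \int[P]_w ((EFin \o X) w - (EFin \o cst m) w).
  by apply: eq_integral => w _ /=; rewrite EFinB.
rewrite integralB//; last exact: finite_measure_integrable_cst.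
rewrite (_ : EFin \o cst m = cst m%:E)// integral_cst//= probability_setT mule1.
have EX : \int[P]_w (EFin \o X) w \is a fin_num by exact: integrable_fin_num.
by rewrite /m unlock fineK// subee.
Qed.

Context {I : finType} {Y : I -> Omega -> R}.
Hypothesis iY : forall k, P.-integrable [set: Omega] (EFin \o Y k).
Hypothesis Y0 : forall k, \int[P]_w (Y k w)%:E = 0.
Hypothesis indY : forall k l, k != l -> independent_pair P (Y k) (Y l).

Let mY k : measurable_fun [set: Omega] (Y k).
Proof. exact/measurable_EFinP/(measurable_int _ (iY k)). Qed.

Let mS : measurable_fun [set: Omega] (fun w => \sum_k Y k w)%R.
Proof. exact: measurable_sum. Qed.

(* Every product [Y k * Y l] is integrable, so the square can be expanded, and
   independence kills the terms off the diagonal. *)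
Let integral_sqr_sum_fin :
  (forall k, \int[P]_w (Y k w ^+ 2)%:E < +oo) ->
  \int[P]_w ((\sum_k Y k w) ^+ 2)%:E = \sum_k \int[P]_w (Y k w ^+ 2)%:E.
Proof.
move=> Y2.
have iYY k l : P.-integrable [set: Omega] (EFin \o (Y k \* Y l)%R).
  have [->|kl] := eqVneq k l; last first.
    by apply: integrable_mul_independent => //; exact: indY.
  apply/integrableP; split.
    by apply/measurable_EFinP; exact: measurable_funM.
  rewrite (eq_integral (fun w => (Y l w ^+ 2)%:E))// => w _.
  by rewrite /= ger0_norm -?expr2 ?sqr_ge0.
transitivity (\int[P]_w \sum_k \sum_l (EFin \o (Y k \* Y l)%R) w).
  apply: eq_integral => w _.
  rewrite expr2 mulr_suml -sumEFin; apply: eq_bigr => k _.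
  by rewrite mulr_sumr -sumEFin.
rewrite integral_sum//; last by move=> k; exact: integrable_sum.
apply: eq_bigr => k _; rewrite integral_sum//.
rewrite (bigD1 k)//= big1 ?adde0// => l lk.
rewrite integral_mul_independent ?Y0 ?mul0e//.
by apply: indY; rewrite eq_sym.
Qed.

(* The value beyond the cutoff is 0, not [M]: then on the event where the
   truncation acts, the truncated variable contributes nothing below. *)
Let trunc (M x : R) : R := if (`|x| <= M)%R then x else 0%R.

Let measurable_trunc M : measurable_fun [set: R] (trunc M).
Proof.
apply: measurable_fun_ifT => //.
by apply: measurable_fun_ler => //; exact: measurableT_comp.
Qed.

(** With [Z] the truncation of [Y k] and [S] the sum, pointwise
    [Z ^ 2 + 2 * Z * (S - Y k) <= S ^ 2]: the right side is
    [(Y k + (S - Y k)) ^ 2] where [Z = Y k], and the left side is 0 where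
    [Z = 0]. As [Z] is bounded and independent of each centered [Y l], the
    cross terms have mean 0. *)
Let truncated_sqr_le k M :
  \int[P]_w (trunc M (Y k w) ^+ 2)%:E <= \int[P]_w ((\sum_k Y k w) ^+ 2)%:E.
Proof.
have [->|] := eqVneq (\int[P]_w ((\sum_k Y k w) ^+ 2)%:E) +oo.
  by rewrite leey.
rewrite -ltey => S2.
pose Z := trunc M \o Y k.
have mZ : measurable_fun [set: Omega] Z by exact: measurableT_comp.
have Zle w : (`|Z w| <= `|M|)%R.
  rewrite /Z/= /trunc; case: ifPn => [/le_trans->//|_]; first exact: ler_norm.
  by rewrite normr0.
have iZ : P.-integrable [set: Omega] (EFin \o Z).
  apply: measurable_bounded_integrable => //.
    by rewrite (le_lt_trans (probability_le1 _ _)) ?ltry.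
  exists `|M|%R; split => // x Mx w _ /=.
  by rewrite (le_trans (Zle w))// ltW.
have iZ2 : P.-integrable [set: Omega] (EFin \o (Z \* Z)%R).
  apply: measurable_bounded_integrable => //.
  - by rewrite (le_lt_trans (probability_le1 _ _)) ?ltry.
  - exact: measurable_funM.
  exists (`|M| * `|M|)%R; split => // x Mx w _ /=.
  by rewrite (le_trans _ (ltW Mx))// normrM ler_pM.
have indZ l : l != k -> independent_pair P Z (Y l).
  rewrite eq_sym => kl.
  have mid : measurable_fun [set: R] (@id R) by exact: measurable_id.
  exact: (independent_pair_comp (measurable_trunc M) mid (indY _ _ kl)).
have iZY l : l != k -> P.-integrable [set: Omega] (EFin \o (Z \* Y l)%R).
  by move=> lk; apply: integrable_mul_independent => //; exact: indZ.
pose W l := if l == k then (Z \* Z)%R else (fun w => 2 * (Z w * Y l w))%R.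
have iW l : P.-integrable [set: Omega] (EFin \o W l).
  rewrite /W; case: eqVneq => // lk.
  rewrite (_ : _ \o _ = fun w => 2%:E * (EFin \o (Z \* Y l)%R) w).
    by apply: integrableZl => //; exact: iZY.
  by apply/funext => w /=; rewrite EFinM.
have -> : \int[P]_w (trunc M (Y k w) ^+ 2)%:E =
    \int[P]_w \sum_l (EFin \o W l) w.
  rewrite integral_sum// (bigD1 k)//= big1 ?adde0.
    by apply: eq_integral => w _; rewrite /W eqxx /= expr2.
  move=> l lk; rewrite /W (negbTE lk).
  under eq_integral do rewrite EFinM.
  rewrite integralZl//; last exact: iZY.
  by rewrite integral_mul_independent ?Y0 ?mule0//; exact: indZ.
apply: le_integral => //.
- exact: integrable_sum.
- apply/integrableP; split.
    by apply/measurable_EFinP; exact: measurable_funX.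
  rewrite (eq_integral (fun w => ((\sum_k Y k w) ^+ 2)%:E))// => w _.
  by rewrite /= ger0_norm ?sqr_ge0.
- move=> w _; rewrite sumEFin lee_fin (bigD1 k)//= {1}/W eqxx.
  rewrite (eq_bigr (fun l => 2 * Z w * Y l w)%R); last first.
    by move=> l /negbTE lk; rewrite /W lk mulrA.
  rewrite -mulr_sumr [X in (_ <= X ^+ 2)%R](bigD1 k)//=.
  rewrite /Z/= /trunc; case: ifPn => _; last first.
    by rewrite !(mulr0, mul0r) add0r sqr_ge0.
  rewrite sqrrD -expr2 -mulrA mulr_natl lerDl.
  by rewrite sqr_ge0.
Qed.

(* Monotone convergence as the cutoff tends to infinity. *)
Let integral_sqr_le_sum k :
  \int[P]_w (Y k w ^+ 2)%:E <= \int[P]_w ((\sum_k Y k w) ^+ 2)%:E.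
Proof.
pose g (n : nat) w := (trunc n%:R (Y k w) ^+ 2)%:E.
have mg n : measurable_fun [set: Omega] (g n).
  apply/measurable_EFinP/measurable_funX.
  exact: (measurableT_comp (measurable_trunc n%:R) (mY k)).
have g0 n w : [set: Omega] w -> 0 <= g n w by rewrite lee_fin sqr_ge0.
have nd_g w : [set: Omega] w -> nondecreasing_seq (g ^~ w).
  move=> _ m n mn; rewrite lee_fin /trunc.
  case: ifPn => [Ym|_]; last by rewrite expr0n sqr_ge0.
  by rewrite ifT// (le_trans Ym)// ler_nat.
have <- : \int[P]_w limn (g ^~ w) = \int[P]_w (Y k w ^+ 2)%:E.
  apply: eq_integral => w _; apply/cvg_lim => //.
  apply: cvg_near_cst; near=> n; rewrite /g /trunc ifT//.
  by near: n; exact: nbhs_infty_ger.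
rewrite monotone_convergence//.
apply: lime_le; last by apply: nearW => n; exact: truncated_sqr_le.
apply: ereal_nondecreasing_is_cvgn => m n mn; apply: ge0_le_integral => //.
  by move=> w wT; exact: g0.
by move=> w wT; exact: (nd_g w wT m n mn).
Unshelve. all: by end_near. Qed.

(** If some second moment is infinite then so is that of the sum, since the
    latter dominates every single one. *)
Lemma integral_sqr_sum_independent :
  \int[P]_w ((\sum_k Y k w) ^+ 2)%:E = \sum_k \int[P]_w (Y k w ^+ 2)%:E.
Proof.
have [/forallP Y2|/forallPn[k]] :=
    boolP [forall k, \int[P]_w (Y k w ^+ 2)%:E < +oo].
  exact: integral_sqr_sum_fin.
rewrite ltey negbK => /eqP Yk.
have ge0 l : 0 <= \int[P]_w (Y l w ^+ 2)%:E.
  by apply: integral_ge0 => w _; rewrite lee_fin sqr_ge0.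
transitivity (+oo : \bar R); last first.
  rewrite (bigD1 k)//= Yk addye// gt_eqF// (lt_le_trans ltNy0)//.
  exact: sume_ge0.
by apply/eqP; rewrite -leye_eq -Yk; exact: integral_sqr_le_sum.
Qed.

End variance_sum.

(** An identity in [0, +oo], obtained by centering the summands. *)
Lemma variance_sum_independent {d} {Omega : measurableType d} {R : realType}
    {P : probability Omega R} {I : finType} {X : I -> Omega -> R} :
  (forall k, P.-integrable [set: Omega] (EFin \o X k)) ->
  (forall k l, k != l -> independent_pair P (X k) (X l)) ->
  'V_P[fun w => (\sum_k X k w)%R] = \sum_k 'V_P[X k].
Proof.
move=> iX indX.
pose m k := fine 'E_P[X k].
have fX k : \int[P]_w (EFin \o X k) w \is a fin_num.
  by apply: integrable_fin_num.
have ES : fine 'E_P[fun w => (\sum_k X k w)%R] = (\sum_k m k)%R.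
  rewrite unlock.
  rewrite (eq_integral (fun w => \sum_k (X k w)%:E)); last first.
    by move=> w _; rewrite sumEFin.
  rewrite integral_sum//= -sum_fine=> [|k _]; last exact: fX.
  by apply: eq_bigr => k _; rewrite /m unlock.
rewrite varianceE_integral ES.
under [RHS]eq_bigr do rewrite varianceE_integral.
rewrite -(integral_sqr_sum_independent (Y := fun k w => X k w - m k)%R).
- by apply: eq_integral => w _; rewrite sumrB.
- by move=> k; exact: integrable_centered.
- by move=> k; exact: integral_centered.
- move=> k l kl.
  have msub (x : R) : measurable_fun [set: R] (fun y => y - x)%R.
    exact: measurable_funB.
  exact: (independent_pair_comp (msub (m k)) (msub (m l)) (indX _ _ kl)).
Qed.

(** * Variance as a least mean square deviation *)

(** The integral is over [A] for the unnormalized [mu], so that spreads of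
    disjoint sets can be added. *)
Definition spread {d} {T : measurableType d} {R : realType}
    (mu : set T -> \bar R) (f : T -> R) (A : set T) : \bar R :=
  ereal_inf (range (fun m : R => \int[mu]_(x in A) ((f x - m) ^+ 2)%:E)).

Lemma spread_ge0 {d} {T : measurableType d} {R : realType}
    {mu : {measure set T -> \bar R}} {f : T -> R} {A : set T} :
  0 <= spread mu f A.
Proof.
apply: le_ereal_inf_tmp => _ [m _ <-].
by apply: integral_ge0 => x _; rewrite lee_fin sqr_ge0.
Qed.

Lemma measurable_sqr_dev {d} {T : measurableType d} {R : realType}
    {f : T -> R} (A : set T) (m : R) :
  measurable_fun [set: T] f ->
  measurable_fun A (fun x => ((f x - m) ^+ 2)%:E).
Proof.
move=> mf; apply: measurable_funTS; apply/measurable_EFinP.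
by apply: measurable_funX; exact: measurable_funB.
Qed.

(** With [mu] the mean and [c = mu - m], the cross term in
    [(X - m) ^ 2 = (X - mu) ^ 2 + 2 * c * (X - mu) + c ^ 2] integrates to 0. *)
Lemma variance_spread {d} {Omega : measurableType d} {R : realType}
    {P : probability Omega R} {X : Omega -> R} :
  P.-integrable [set: Omega] (EFin \o X) ->
  'V_P[X] = spread P X [set: Omega].
Proof.
move=> iX; apply/eqP; rewrite eq_le; apply/andP; split; last first.
  by rewrite varianceE_integral; apply: ereal_inf_lbound; exists (fine 'E_P[X]).
have mX : measurable_fun [set: Omega] X.
  exact/measurable_EFinP/(measurable_int _ iX).
apply: le_ereal_inf_tmp => _ [m _ <-].
rewrite varianceE_integral; set mu := fine _.
have [->|] := eqVneq (\int[P]_w ((X w - m) ^+ 2)%:E) +oo; first by rewrite leey.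
rewrite -ltey => fin.
pose c := (mu - m)%R.
have i1 : P.-integrable [set: Omega] (fun w => ((X w - m) ^+ 2)%:E).
  apply/integrableP; split; first exact: measurable_sqr_dev.
  rewrite (eq_integral (fun w => ((X w - m) ^+ 2)%:E))// => w _.
  by rewrite /= ger0_norm ?sqr_ge0.
have i2 : P.-integrable [set: Omega]
    (fun w => (- (c *+ 2))%:E * (EFin \o (fun w => X w - mu)%R) w).
  by apply: integrableZl => //; exact: integrable_centered.
(* Subtracting the cross term does not change the integral, and what remains,
   [(X - mu) ^ 2 + c ^ 2], is nonnegative and dominates [(X - mu) ^ 2]. *)
have -> : \int[P]_w ((X w - m) ^+ 2)%:E =
    \int[P]_w (((X w - m) ^+ 2)%:E +
               (- (c *+ 2))%:E * (EFin \o (fun w => X w - mu)%R) w).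
  rewrite integralD// integralZl//; last exact: integrable_centered.
  by rewrite integral_centered// mule0 adde0.
have key w : ((X w - m) ^+ 2 + - (c *+ 2) * (X w - mu) =
              (X w - mu) ^+ 2 + c ^+ 2)%R by rewrite /c; ring.
apply: ge0_le_integral => //.
- by move=> w _; rewrite lee_fin sqr_ge0.
- exact: measurable_sqr_dev.
- by have /integrableP[] := integrableD measurableT i1 i2.
- by move=> w _ /=; rewrite lee_fin key lerDl sqr_ge0.
Qed.

Lemma variance_distribution {d d'} {Omega : measurableType d}
    {T : measurableType d'} {R : realType} {P : probability Omega R}
    {X : {RV P >-> T}} {f : T -> R} :
  measurable_fun [set: T] f ->
  P.-integrable [set: Omega] (EFin \o (f \o X)) ->
  'V_P[f \o X] = spread (distribution P X) f [set: T].
Proof.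
move=> mf iX; rewrite (variance_spread iX); congr ereal_inf.
congr (_ @` _); apply/funext => m; rewrite ge0_integral_distribution//.
- exact: measurable_sqr_dev.
- by move=> y; rewrite lee_fin sqr_ge0.
Qed.

Lemma spread_same_law {d} {T : measurableType d} {R : realType}
    {mu nu : {measure set T -> \bar R}} (f : T -> R) :
  same_law mu nu -> spread mu f [set: T] = spread nu f [set: T].
Proof.
move=> munu; congr ereal_inf; congr (_ @` _); apply/funext => m.
by apply: eq_measure_integral => A mA _; exact: munu.
Qed.

(** A constant [m] for the union serves as a candidate in each part. *)
Lemma sum_spread_le {d} {T : measurableType d} {R : realType}
    {mu : {measure set T -> \bar R}} {f : T -> R} {I : finType}
    {J : {set I}} {B : I -> set T} :
  measurable_fun [set: T] f -> (forall i, measurable (B i)) ->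
  trivIset [set: I] B ->
  \sum_(i in J) spread mu f (B i) <= spread mu f (\bigcup_(i in [set` J]) B i).
Proof.
move=> mf mB tB; apply: le_ereal_inf_tmp => _ [m _ <-].
have -> : \bigcup_(i in [set` J]) B i = \big[setU/set0]_(i <- enum J) B i.
  rewrite -bigcup_seq; apply: eq_bigcupl.
  by split => i /=; rewrite mem_enum.
rewrite ge0_integral_bigsetU ?enum_uniq//.
- rewrite big_enum; apply: lee_sum => i _.
  by apply: ereal_inf_lbound; exists m.
- exact: sub_trivIset tB.
- exact: measurable_sqr_dev.
- by move=> x _; rewrite lee_fin sqr_ge0.
Qed.

Section conditional_law.
Context {dO d d'} {Omega : measurableType dO} {T : measurableType d}
  {Omega' : measurableType d'} {R : realType} {P : probability Omega R}
  {P' : probability Omega' R} {U : {RV P >-> T}} {B : set T}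
  {X : {RV P' >-> T}} {p : R}.
Hypotheses (mB : measurable B) (p0 : (0 < p)%R) (PB : P (U @^-1` B) = p%:E).
Hypothesis lawX : same_law (distribution P' X) (cond_law U B).

Let cond_lawE A : measurable A ->
  distribution P' X A = p^-1%:E * distribution P U (A `&` B).
Proof.
by move=> mA; rewrite lawX// /cond_law PB muleC inver gt_eqF.
Qed.

(** The conditional law gives mass 0 to the complement of [B] and is
    [p^-1] times the law of [U] on subsets of [B]. *)
Lemma ge0_integral_cond_law {h : T -> \bar R} :
  measurable_fun [set: T] h -> (forall x, 0 <= h x) ->
  \int[distribution P' X]_x h x = p^-1%:E * \int[distribution P U]_(x in B) h x.
Proof.
move=> mh h0.
have pV0 : (0 <= p^-1)%R by rewrite invr_ge0 ltW.
pose q : {nonneg R} := NngNum pV0.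
have lawB A : measurable A -> A `<=` B ->
    distribution P' X A = mscale q (distribution P U) A.
  by move=> mA AB; rewrite cond_lawE// (setIidl AB).
rewrite -(setvU B) ge0_integral_setU ?setvU//; last 2 first.
- exact: measurableC.
- by rewrite disj_set2E setICl.
rewrite null_set_integral ?add0e; last 3 first.
- exact: measurableC.
- exact: measurable_funTS.
- by rewrite [LHS]cond_lawE ?setICl ?measure0 ?mule0//; exact: measurableC.
rewrite (eq_measure_integral (mscale q (distribution P U))).
  rewrite ge0_integral_mscale//; exact: measurable_funTS.
exact: lawB.
Qed.

Lemma integrable_cond_law {f : T -> R} :
  measurable_fun [set: T] f ->
  (distribution P U).-integrable [set: T] (EFin \o f) ->
  P'.-integrable [set: Omega'] (EFin \o (f \o X)).
Proof.
move=> mf /integrableP[_ fU]; apply/integrableP; split.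
  by apply/measurable_EFinP; exact: measurableT_comp.
have mabs : measurable_fun [set: T] (fun x => `|(f x)%:E|).
  by apply: measurableT_comp => //; exact/measurable_EFinP.
rewrite -(@ge0_integral_distribution _ _ _ _ _ P' X (fun x => `|(f x)%:E|))//.
rewrite ge0_integral_cond_law// lte_mul_pinfty ?lee_fin ?invr_ge0 ?ltW//.
rewrite (le_lt_trans _ fU)//; apply: ge0_subset_integral => //.
Qed.

Lemma variance_cond_law {f : T -> R} :
  measurable_fun [set: T] f ->
  (distribution P U).-integrable [set: T] (EFin \o f) ->
  'V_P'[f \o X] = p^-1%:E * spread (distribution P U) f B.
Proof.
move=> mf iU; rewrite variance_distribution//; last exact: integrable_cond_law.
rewrite /spread -ereal_inf_pZl ?invr_gt0// image_comp.
congr ereal_inf; congr (_ @` _); apply/funext => m /=.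
apply: ge0_integral_cond_law; first exact: measurable_sqr_dev.
by move=> x; rewrite lee_fin sqr_ge0.
Qed.

End conditional_law.

(** * Variance of the stratified estimator *)

Lemma mutually_independent_pair {d d'} {Omega : measurableType d}
    {T : measurableType d'} {R : realType} {P : probability Omega R}
    {I : finType} {D : {set I}} {X : I -> Omega -> T} {i j : I} :
  mutually_independent P D X -> i \in D -> j \in D -> i != j ->
  independent_pair P (X i) (X j).
Proof.
move=> indX iD jD ij E F mE mF.
pose G k := if k == i then E else F.
have ijD : [set i; j]%SET \subset D by apply/fintype.subsetP => k /set2P[] ->.
have mG k : k \in [set i; j]%SET -> measurable (G k) by rewrite /G; case: ifPn.
have := indX _ _ ijD mG.
rewrite big_setU1 ?inE//= big_set1 /G eqxx eq_sym (negbTE ij) => <-.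
congr (P _); apply/seteqP; split => [w [Ew Fw] k /=|w XEF].
  by rewrite !inE => /orP[] /eqP ->; rewrite ?eqxx// eq_sym (negbTE ij).
split.
- by have := XEF i; rewrite /= !inE eqxx; apply.
- by have := XEF j; rewrite /= !inE eqxx orbT eq_sym (negbTE ij); apply.
Qed.

Lemma independent_families_pair {d d1 d2} {Omega : measurableType d}
    {T1 : measurableType d1} {T2 : measurableType d2} {R : realType}
    {P : probability Omega R} {I J : finType} {D : {set I}} {D' : {set J}}
    {X : I -> Omega -> T1} {Y : J -> Omega -> T2} {i : I} {j : J} :
  independent_families P D X D' Y -> i \in D -> j \in D' ->
  independent_pair P (X i) (Y j).
Proof.
move=> indXY iD jD E F mE mF; apply: indXY; apply: sub_gen_smallest.
- by exists i => //; exists E => //; rewrite setTI.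
- by exists j => //; exists F => //; rewrite setTI.
Qed.

(** The hypothesis says that the sets [D i] partition the indices [j]. It serves
    twice: for the draws of each block, and for the blocks of a finer partition
    inside each block of a coarser one. *)
Lemma big_blocks {S : Type} {idx : S} {op : Monoid.com_law idx}
    {I J : finType} {D : I -> {set J}} {blk : J -> I} (F : I -> J -> S) :
  (forall i j, (j \in D i) = (i == blk j)) ->
  \big[op/idx]_i \big[op/idx]_(j in D i) F i j = \big[op/idx]_j F (blk j) j.
Proof.
move=> DE; rewrite (exchange_big_dep xpredT)//=; apply: eq_bigr => j _.
by under eq_bigl do rewrite DE; rewrite big_pred1_eq.
Qed.

Section estimator_variance.
Context {R : realType} {dO} {Omega : measurableType dO}
  {P : probability Omega R} {dU} {T : measurableType dU} {U : {RV P >-> T}}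
  {f : T -> R} {n : nat} {eps : {RV P >-> R}} {b : nat} {B : 'I_b -> set T}
  {k : 'I_b -> nat} {Bs : 'I_b -> {set 'I_n}} {d'}
  {Omega' : measurableType d'} {P' : probability Omega' R}
  {V : 'I_b -> 'I_n -> {RV P' >-> T}} {e : 'I_n -> {RV P' >-> R}}.
Hypotheses (mf : measurable_fun [set: T] f)
  (fU : (distribution P U).-integrable [set: T] (EFin \o f))
  (n0 : (0 < n)%N)
  (ieps : P.-integrable [set: Omega] (EFin \o eps))
  (admB : admissible U n B k) (asB : associated k Bs)
  (IE : IE_sample U eps B Bs V e).

(* Putting the factor [1 / n] of the estimator inside each summand avoids
   scaling a possibly infinite variance. *)
Let scale (x : R) : R := (n%:R^-1 * x)%R.

Let measurable_scale : measurable_fun [set: R] scale.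
Proof. exact: measurable_funM. Qed.

Let g := scale \o f.

Let mg : measurable_fun [set: T] g.
Proof. exact: measurableT_comp. Qed.

Let integrable_scale {d} {S : measurableType d}
    {mu : {measure set S -> \bar R}} {h : S -> R} :
  mu.-integrable [set: S] (EFin \o h) ->
  mu.-integrable [set: S] (EFin \o (scale \o h)).
Proof.
move=> ih; rewrite (_ : _ \o _ = fun x => n%:R^-1%:E * (EFin \o h) x).
  exact: integrableZl.
by apply/funext => x /=; rewrite EFinM.
Qed.

Let ig : (distribution P U).-integrable [set: T] (EFin \o g).
Proof. exact: integrable_scale. Qed.

Let ratio_gt0 i : (0 < (k i)%:R / n%:R :> R)%R.
Proof.
by have /andP[k1 _] := adm_range admB i; rewrite divr_gt0// ltr0n.
Qed.

Let blk j : 'I_b := sval (cid (assoc_cover asB j)).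

Let blkE i j : (j \in Bs i) = (i == blk j).
Proof.
have jblk : j \in Bs (blk j) by rewrite /blk; case: cid.
apply/idP/eqP => [ji|-> //]; exact: (assoc_disjoint asB) ji jblk.
Qed.

Let blk_in j : j \in Bs (blk j). Proof. by rewrite blkE. Qed.

(* The left copy of the index set carries the values of [f], the right copy the
   noise; [blk j] is the block from which draw [j] is taken. *)
Let summand (s : 'I_n + 'I_n) : Omega' -> R :=
  match s with
  | inl j => g \o V (blk j) j
  | inr j => scale \o e j
  end.

Let W_IE_summand : W_IE f Bs V e = fun w => (\sum_s summand s w)%R.
Proof.
apply/funext => w; rewrite /W_IE (big_blocks _ blkE) big_sumType/= mulr_sumr.
rewrite -big_split/=; apply: eq_bigr => j _; exact: mulrDr.
Qed.

Let iscale_eps : P.-integrable [set: Omega] (EFin \o (scale \o eps)).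
Proof. exact: integrable_scale. Qed.

Let integrable_noise j : P'.-integrable [set: Omega'] (EFin \o (scale \o e j)).
Proof.
apply/integrableP; split.
  by apply/measurable_EFinP; exact: measurableT_comp.
have mabs : measurable_fun [set: R] (fun x => `|(scale x)%:E|).
  by apply: measurableT_comp => //; exact/measurable_EFinP.
rewrite -(@ge0_integral_distribution _ _ _ _ _ P' (e j)
  (fun x => `|(scale x)%:E|))//.
rewrite (eq_measure_integral (distribution P eps)); last first.
  by move=> A mA _; exact: (IE_law_eps IE).
rewrite ge0_integral_distribution//.
by have /integrableP[] := iscale_eps.
Qed.

Let integrable_summand s : P'.-integrable [set: Omega'] (EFin \o summand s).
Proof.
case: s => j /=; last exact: integrable_noise.
exact: (integrable_cond_law (adm_measurable admB _) (ratio_gt0 _)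
  (adm_prob admB _) (IE_law_V IE (blk_in j))).
Qed.

Let independent_summands s t :
  s != t -> independent_pair P' (summand s) (summand t).
Proof.
have inP j : (blk j, j) \in IE_pairs Bs by rewrite inE /=.
case: s t => [i|i] [j|j] ij /=; apply: independent_pair_comp => //.
- apply: (mutually_independent_pair (IE_indep_V IE) (inP i) (inP j)).
  by apply: contra ij => /eqP[_ ->].
- exact: (independent_families_pair (IE_indep_V_eps IE) (inP i)).
- move=> E F mE mF; rewrite setIC muleC.
  exact: (independent_families_pair (IE_indep_V_eps IE) (inP j) _ _ _ mF mE).
- exact: (mutually_independent_pair (IE_indep_eps IE)).
Qed.

(** The second term is expressed through [eps] alone, hence does not depend on
    the partition. *)
Lemma variance_W_IE :
  'V_P'[W_IE f Bs V e] =
  n%:R%:E * (\sum_i spread (distribution P U) g (B i)) +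
  \sum_(j < n) 'V_P[scale \o eps].
Proof.
rewrite W_IE_summand (variance_sum_independent integrable_summand)//.
rewrite big_sumType/=; congr (_ + _); last first.
  apply: eq_bigr => j _; rewrite !variance_distribution//.
  by apply: spread_same_law; exact: (IE_law_eps IE).
under eq_bigr => j _ do rewrite (variance_cond_law (adm_measurable admB _)
  (ratio_gt0 _) (adm_prob admB _) (IE_law_V IE (blk_in j)) mg ig).
pose v i := (((k i)%:R / n%:R)^-1)%:E * spread (distribution P U) g (B i).
rewrite -(big_blocks (fun i _ => v i) blkE).
rewrite ge0_sume_distrr => [|i _]; last exact: spread_ge0.
apply: eq_bigr => i _.
transitivity ((k i)%:R%:E * v i).
  by rewrite mule_natl sumr_const (assoc_card asB).
have k0 : (k i)%:R != 0%R :> R.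
  by have /andP[k1 _] := adm_range admB i; rewrite pnatr_eq0 -lt0n.
by rewrite /v muleA -EFinM invf_div mulrC divfK.
Qed.

End estimator_variance.

(** Blocks have positive probability, hence are nonempty, so each [B i] lies in
    exactly one [C l] and the sum over [i] regroups along the sum over [l]. *)
Lemma sum_spread_refines {R : realType} {dO} {Omega : measurableType dO}
    {P : probability Omega R} {dU} {T : measurableType dU} {U : {RV P >-> T}}
    {f : T -> R} {n : nat} {b : nat} {B : 'I_b -> set T} {kB : 'I_b -> nat}
    {c : nat} {C : 'I_c -> set T} {kC : 'I_c -> nat} :
  measurable_fun [set: T] f ->
  admissible U n B kB -> admissible U n C kC -> refines B C ->
  \sum_i spread (distribution P U) f (B i) <=
  \sum_l spread (distribution P U) f (C l).
Proof.
move=> mf admB admC BC.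
pose J l := sval (cid (BC l)).
have CE l : C l = \bigcup_(i in [set` J l]) B i by rewrite /J; case: cid.
have Bnonempty i : B i !=set0.
  apply/set0P/eqP => Bi0; have := adm_prob admB i.
  rewrite Bi0 preimage_set0 measure0 => /esym[] /eqP.
  have /andP[k1 kn] := adm_range admB i.
  by rewrite gt_eqF// divr_gt0// ltr0n//; exact: leq_trans kn.
pose x i := sval (cid (Bnonempty i)).
have Bx i : B i (x i) by rewrite /x; case: cid.
have inC i : exists l, C l (x i).
  have : (\bigcup_l C l) (x i) by rewrite (adm_cover admC).
  by case=> l _ ?; exists l.
pose par i := sval (cid (inC i)).
have Cpar i : C (par i) (x i) by rewrite /par; case: cid.
have parE l i : (i \in J l) = (l == par i).
  have inJ l' : C l' (x i) -> i \in J l'.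
    rewrite CE => -[i' /= i'J Bi'].
    rewrite (_ : i = i')//; apply: (adm_disjoint admB) => //.
    by exists (x i).
  apply/idP/eqP => [iJ|->]; last exact: inJ.
  apply: (adm_disjoint admC) => //; exists (x i); split => //.
  by rewrite CE; exists i.
rewrite -(big_blocks (fun _ i => spread (distribution P U) f (B i)) parE).
apply: lee_sum => l _; rewrite CE; apply: sum_spread_le => //.
- exact: adm_measurable admB.
- exact: adm_disjoint admB.
Qed.

Theorem theorem4p1 (R : realType)
    (dO : measure_display) (Omega : measurableType dO) (P : probability Omega R)
    (dU : measure_display) (T : measurableType dU)
    (U : {RV P >-> T}) (f : T -> R) (n : nat) (eps : {RV P >-> R})
    (b : nat) (B : 'I_b -> set T) (kB : 'I_b -> nat) (Bs : 'I_b -> {set 'I_n})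
    (c : nat) (C : 'I_c -> set T) (kC : 'I_c -> nat) (Cs : 'I_c -> {set 'I_n})
    (dB : measure_display) (OmegaB : measurableType dB)
    (PB : probability OmegaB R)
    (VB : 'I_b -> 'I_n -> {RV PB >-> T}) (epsB : 'I_n -> {RV PB >-> R})
    (dC : measure_display) (OmegaC : measurableType dC)
    (PC : probability OmegaC R)
    (VC : 'I_c -> 'I_n -> {RV PC >-> T}) (epsC : 'I_n -> {RV PC >-> R}) :
  non_atomic (distribution P U) ->
  measurable_fun [set: T] f ->
  'E_P[fun w => `|f (U w)|%R] < +oo ->
  (1 <= n)%N ->
  P.-integrable [set: Omega] (EFin \o eps) ->
  'E_P[eps] = 0 ->
  'V_P[eps] < +oo ->
  admissible U n B kB -> associated kB Bs ->
  admissible U n C kC -> associated kC Cs ->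
  refines B C ->
  IE_sample U eps B Bs VB epsB ->
  IE_sample U eps C Cs VC epsC ->
  'V_PB[W_IE f Bs VB epsB] <= 'V_PC[W_IE f Cs VC epsC].
Proof.
move=> _ mf Ef n1 ieps _ _ admB asB admC asC BC IEB IEC.
have fU : (distribution P U).-integrable [set: T] (EFin \o f).
  apply/integrableP; split; first exact/measurable_EFinP.
  rewrite ge0_integral_distribution//; first by rewrite unlock in Ef.
  by apply: measurableT_comp => //; exact/measurable_EFinP.
rewrite (variance_W_IE mf fU n1 ieps admB asB IEB).
rewrite (variance_W_IE mf fU n1 ieps admC asC IEC).
rewrite leeD2r// lee_pmul2l ?lte_fin ?ltr0n//.
apply: sum_spread_refines admB admC BC.
exact: measurable_funM.
Qed.
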